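(* Consider the finite-template mean-shift detection model with templates $M_1,\dots,M_m\in\mathbb{R}^{k\times k}$ (described in the context). Let $\ell_{\max}\in\arg\max_{\ell\in[m]}\|M_\ell\|_F^2$ and $M_{\max}=M_{\ell_{\max}}$, and let $\mu_{\mathsf{det}}=\sum_{\ell=1}^m\sum_{u,v\in[k]}(M_\ell)_{uv}$. The following statements hold. 1. If $|\mu_{\mathsf{det}}|=\omega(n)$, then the global sum test $\mathcal{A}_{\mathsf{sum}}$ satisfies $\mathsf{R}(\mathcal{A}_{\mathsf{sum}})=o(1)$ under the non-consecutive placement family $\mathcal{K}_{k,m,n}$ and under both consecutive placement families $\mathcal{K}^{\mathsf{con}}_{k,m,n}$ and $\mathcal{K}^{\circ}_{k,m,n}$. 2. If $\|M_{\max}\|_F^2=\omega\left(k\log\frac{n}{k}\right)$, then, under the non-consecutive placement family $\mathcal{K}_{k,m,n}$, the template-aware scan test $\mathcal{A}^{\mu}_{\mathsf{scan,max}}(\cdot\,;\mathcal{B}_{k,n})$ satisfies $\mathsf{R}(\mathcal{A}^{\mu}_{\mathsf{scan,max}})=o(1)$. 3. If $\|M_{\max}\|_F^2=\omega(\log n)$, then, under the standard consecutive placement family $\mathcal{K}^{\mathsf{con}}_{k,m,n}$, the template-aware scan test $\mathcal{A}^{\mu}_{\mathsf{scan,max}}(\cdot\,;\mathcal{B}^{\mathsf{con}}_{k,n})$ satisfies $\mathsf{R}(\mathcal{A}^{\mu}_{\mathsf{scan,max}})=o(1)$; the same holds for $\mathcal{A}^{\mu}_{\mathsf{scan,max}}(\cdot\,;\mathcal{B}^{\circ}_{k,n})$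 under the circular consecutive placement family $\mathcal{K}^{\circ}_{k,m,n}$.
   Context: **Asymptotics.** All asymptotic statements are as $n\to\infty$; $m=m(n)$, $k=k(n)$ are positive integers with $mk\le n$, and the templates may depend on $n$. $[k]=\{1,\dots,k\}$; $\|M\|_F^2=\sum_{i,j}M_{ij}^2$; $a_n=\omega(b_n)$ and $o(1)$ have their usual meanings. **Blocks and placements.** $\mathcal{B}_{k,n}=\{S\times T: S,T\subset[n],\ |S|=|T|=k\}$ (non-consecutive blocks). $\mathcal{B}^{\mathsf{con}}_{k,n}$ is the set of $S\times T$ with $S,T\in\{\{i+1,\dots,i+k\}:i=0,\dots,n-k\}$ (standard consecutive). $\mathcal{B}^{\circ}_{k,n}$ is the set of $S\times T$ with $S,T\in\{\{i+1,\dots,i+k\}\bmod n: i=0,\dots,n-1\}$, indices taken modulo $n$ with representatives in $[n]$ (circular consecutive). The placement families $\mathcal{K}_{k,m,n}$, $\mathcal{K}^{\mathsf{con}}_{k,m,n}$, $\mathcal{K}^{\circ}_{k,m,n}$ are the sets of all unordered collections of $m$ pairwise disjoint blocks from $\mathcal{B}_{k,n}$, $\mathcal{B}^{\mathsf{con}}_{k,n}$, $\mathcal{B}^{\circ}_{k,n}$, respectively. For a block $B=S\times T$ with $S=\{s_1<\dots<s_k\}$, $T=\{t_1<\dots<t_k\}$, the coordinate map $\varphi_B:B\to[k]\times[k]$ is $\varphi_B(s_u,t_v)=(u,v)$. **Mean-shift model.** One observes $X\in\mathbb{R}^{n\times n}$. Under $\mathcal{H}_0$ the entries are i.i.d. $\mathcal{N}(0,1)$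 (law $\mathbb{P}_{\mathcal{H}_0}$). Under $\mathcal{H}_1$, $K$ is drawn uniformly from the specified placement family, then, conditional on $K$, a bijection $\beta:K\to[m]$ is drawn uniformly; given $(K,\beta)$ the entries of $X$ are independent with $X_{ij}\sim\mathcal{N}\big((M_{\beta(B)})_{\varphi_B(i,j)},1\big)$ if $(i,j)\in B$ for some $B\in K$, and $X_{ij}\sim\mathcal{N}(0,1)$ otherwise. $\mathbb{P}_{\mathcal{H}_1}$ is the resulting marginal (mixture) law of $X$. The risk of a test $\mathcal{A}_n:\mathbb{R}^{n\times n}\to\{0,1\}$ is $\mathsf{R}(\mathcal{A}_n)=\mathbb{P}_{\mathcal{H}_0}(\mathcal{A}_n(X)=1)+\mathbb{P}_{\mathcal{H}_1}(\mathcal{A}_n(X)=0)$. **Global sum test.** Defined when $\mu_{\mathsf{det}}\ne 0$: $\mathcal{A}_{\mathsf{sum}}(X)=\mathbb{1}\{\operatorname{sign}(\mu_{\mathsf{det}})\sum_{i,j\in[n]}X_{ij}\ge |\mu_{\mathsf{det}}|/2\}$. **Template-aware scan test.** For $\mathcal{B}\in\{\mathcal{B}_{k,n},\mathcal{B}^{\mathsf{con}}_{k,n},\mathcal{B}^{\circ}_{k,n}\}$, $$\mathcal{A}^{\mu}_{\mathsf{scan,max}}(X;\mathcal{B})=\mathbb{1}\Big\{\max_{B\in\mathcal{B}}\sum_{(i,j)\in B}(M_{\max})_{\varphi_B(i,j)}X_{ij}\ge\tau^{\mu}_{\mathsf{scan}}(\mathcal{B})\Big\},$$ where, for a fixed constant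 $\delta>0$, $\tau^{\mu}_{\mathsf{scan}}(\mathcal{B}_{k,n})=\sqrt{(4+\delta)\|M_{\max}\|_F^2\,k\log\frac{en}{k}}$ and $\tau^{\mu}_{\mathsf{scan}}(\mathcal{B})=\sqrt{(4+\delta)\|M_{\max}\|_F^2\log n}$ for $\mathcal{B}\in\{\mathcal{B}^{\mathsf{con}}_{k,n},\mathcal{B}^{\circ}_{k,n}\}$.
   Formalization: In part 2 it is also assumed that ‖M_max‖_F² = ω(k) along those n with k > n/2 (together: ω(k log(en/k))); as stated, part 2 fails for m = 1, k = n−1, ‖M_1‖_F² = √n, where the threshold exceeds the scan statistic. *)

(* Defs.v *)
From HB Require Import structures.
From mathcomp Require Import all_boot all_order all_algebra.
From mathcomp Require Import all_classical all_reals all_analysis.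

Set Implicit Arguments.
Unset Strict Implicit.
Unset Printing Implicit Defensive.

Import Order.TTheory GRing.Theory Num.Theory.
Import numFieldNormedType.Exports.

Local Open Scope classical_set_scope.
Local Open Scope ring_scope.

(* MathComp and MathComp-Analysis over an arbitrary [R : realType].  Indices
   run from 0, i.e. the index set [n] is ['I_n] and [k] is ['I_k]. *)

Section finite_product.
Context d (T : measurableType d) (R : realType).

Definition cons_tuple N (x : T * N.-tuple T) : N.+1.-tuple T :=
  [tuple of x.1 :: x.2].

Lemma measurable_cons_tuple N : measurable_fun setT (@cons_tuple N).
Proof. exact: (@measurable_cons _ _ _ _ fst N snd). Qed.

HB.instance Definition _ N :=
  isMeasurableFun.Build _ _ _ _ (@cons_tuple N) (@measurable_cons_tuple N).

Fixpoint product_law N : ('I_N -> probability T R) -> probability (N.-tuple T) R :=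
  match N with
  | 0%N => fun _ => \d_[tuple]
  | N'.+1 => fun P =>
      distribution (P ord0 \x product_law (fun i => P (lift ord0 i)))%E
        (@cons_tuple N')
  end.

Lemma product_law_rect N (P : 'I_N -> probability T R) (A : 'I_N -> set T) :
  (forall i, measurable (A i)) ->
  product_law P [set x | forall i, A i (tnth x i)] = (\prod_(i < N) P i (A i))%E.
Proof.
elim: N P A => [|N IH] P A mA.
  rewrite big_ord0 /= diracE mem_set//; by case.
rewrite big_ord_recl -IH//= /distribution /pushforward.
rewrite -product_measure1E//.
  congr (_ _); apply/seteqP; split => -[x y] /=.
    move=> h; split; first exact: (h ord0).
    by move=> i; have := h (lift ord0 i); rewrite tnthS/=; congr (A _ _);
      apply: eq_from_tnth.
    move=> [h0 h] i; case: (unliftP ord0 i) => [j|] -> //=.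
    by have := h j; rewrite tnthS; congr (A _ _); apply: eq_from_tnth.
rewrite (_ : [set x | _] = \bigcap_(i in [set: 'I_N])
    ((fun x : N.-tuple T => tnth x i) @^-1` A (lift ord0 i))).
  apply: fin_bigcap_measurable => // i _.
  by rewrite -[X in measurable X]setTI; exact: measurable_tnth.
by apply/seteqP; split => x /= h i; [move=> _; exact: h | exact: (h i I)].
Qed.
End finite_product.

(* Matrices carry the sigma-algebra generated by their entries. *)
Section matrix_measurable.
Context d (T : measurableType d) (m n : nat).

Definition mx_rect : set (set 'M[T]_(m, n)) :=
  [set A | exists (i : 'I_m) (j : 'I_n) (B : set T), measurable B /\ A = [set X : 'M[T]_(m, n) | B (X i j)]].

Let mx_set0 : <<s mx_rect >> set0.
Proof. exact: sigma_algebra0. Qed.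

Let mx_setC A : <<s mx_rect >> A -> <<s mx_rect >> (~` A).
Proof. exact: sigma_algebraC. Qed.

Let mx_bigcup (F : (set _)^nat) : (forall i, <<s mx_rect >> (F i)) ->
  <<s mx_rect >> (\bigcup_i (F i)).
Proof. exact: sigma_algebra_bigcup. Qed.

HB.instance Definition _ := @isMeasurable.Build d
  'M[T]_(m, n) <<s mx_rect >> mx_set0 mx_setC mx_bigcup.

Definition mx_of_tuple (x : (m * n).-tuple T) : 'M[T]_(m, n) :=
  \matrix_(i, j) tnth x (mxvec_index i j).

Lemma measurable_mx_of_tuple : measurable_fun setT mx_of_tuple.
Proof.
apply: (@measurability _ _ _ _ _ _ mx_rect) => //.
move=> _ [_ [i [j [B [mB ->]]]] <-]; rewrite setTI.
rewrite (_ : _ @^-1` _ = (fun x => tnth x (mxvec_index i j)) @^-1` B).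
  by rewrite -[X in measurable X]setTI; exact: measurable_tnth.
by apply/funext => x; rewrite /preimage /= mxE.
Qed.

HB.instance Definition _ :=
  isMeasurableFun.Build _ _ _ _ mx_of_tuple measurable_mx_of_tuple.
End matrix_measurable.

Section gauss.
Context (R : realType).

(* The law of an n x n matrix with independent N(theta i j, 1) entries;
   [gaussian_mx_rect] below characterizes it. *)
Definition gaussian_mx n (theta : 'M[R]_n) : probability 'M[measurableTypeR R]_n R :=
  distribution
    (product_law (fun p : 'I_(n * n) => normal_prob (mxvec theta ord0 p) 1))
    (@mx_of_tuple _ _ n n).

Lemma gaussian_mx_rect n (theta : 'M[R]_n)
    (A : 'I_n -> 'I_n -> set (measurableTypeR R)) :
  (forall i j, measurable (A i j)) ->
  gaussian_mx theta [set X : 'M[R]_n | forall i j, A i j (X i j)] =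
  (\prod_(i < n) \prod_(j < n) normal_prob (theta i j) 1 (A i j))%E.
Proof.
move=> mA; rewrite pair_bigA /=.
have [g gK _] := curry_mxvec_bij n n.
rewrite /gaussian_mx /distribution /pushforward /=.
rewrite (_ : _ @^-1` _ = [set x : (n * n).-tuple (measurableTypeR R) |
    forall p, A (g p).1 (g p).2 (tnth x p)]); last first.
  apply/seteqP; split => x /= h.
    move=> p; case/mxvec_indexP: p => i j.
    by have := gK (i, j) isT; rewrite /= => ->; have := h i j; rewrite mxE.
  by move=> i j; have := h (mxvec_index i j); have := gK (i, j) isT;
    rewrite /= => ->; rewrite mxE.
rewrite (product_law_rect _ (A := fun p => A (g p).1 (g p).2))//.
rewrite (reindex _ (curry_mxvec_bij n n)); apply: eq_bigr => -[i j] _ /=.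
by have := gK (i, j) isT; rewrite /= => ->; rewrite mxvecE.
Qed.
End gauss.

Section blocks.
Variables n k : nat.

(* The block S x T is encoded by the pair (S, T); this is faithful for k > 0. *)
Definition block := ({set 'I_n} * {set 'I_n})%type.

Definition cells (B : block) : {set 'I_n * 'I_n} := finset.setX B.1 B.2.

Definition product_blocks (F : {set {set 'I_n}}) : {set block} :=
  finset.setX F F.

Definition con_interval (i : nat) : {set 'I_n} :=
  [set j : 'I_n | (i <= j < i + k)%N]%SET.

Definition circular_interval (i : nat) : {set 'I_n} :=
  [set j : 'I_n | [exists l : 'I_k, (j : nat) == ((i + l) %% n)%N]]%SET.

Definition blocks_all : {set block} :=
  product_blocks [set S : {set 'I_n} | #|S| == k]%SET.

Definition blocks_con : {set block} :=
  product_blocks [set con_interval i | i : 'I_(n - k).+1]%SET.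

Definition blocks_circ : {set block} :=
  product_blocks [set circular_interval i | i : 'I_n]%SET.

Definition placements (m : nat) (Bs : {set block}) : {set {set block}} :=
  [set K : {set block} | [&& #|K| == m, K \subset Bs &
    [forall B in K, forall B' in K,
      (B != B') ==> [disjoint cells B & cells B']]]]%SET.

(* [coord S] sends the u-th smallest element of S to u ([enum S] is listed in
   increasing order), and is None outside S when #|S| = k. *)
Definition coord (S : {set 'I_n}) (i : 'I_n) : option 'I_k :=
  insub (index i (enum S)).

End blocks.

Section model.
Variables (R : realType) (n k m : nat).
Variable M : 'I_m -> 'M[R]_k.

(* The entry of the template A at phi_B(i,j), for a cell (i,j) of B. *)
Definition template_entry (A : 'M[R]_k) (B : block n) (i j : 'I_n) : R :=
  if (coord k B.1 i, coord k B.2 j) is (Some u, Some v) then A u v else 0.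

Definition bijections (K : {set block n}) :
    {set {ffun {B : block n | B \in K} -> 'I_m}} :=
  [set b : {ffun {B : block n | B \in K} -> 'I_m} |
    injectiveb b && [forall l, l \in codom b]]%SET.

(* The pick is unambiguous when the blocks of K are pairwise disjoint. *)
Definition signal_mean (K : {set block n})
    (b : {ffun {B : block n | B \in K} -> 'I_m}) : 'M[R]_n :=
  \matrix_(i, j)
    if [pick B : {B : block n | B \in K} | (i, j) \in cells (val B)] is Some B
    then template_entry (M (b B)) (val B) i j else 0.

Definition law_H0 : set 'M[R]_n -> \bar R := gaussian_mx (0 : 'M[R]_n).

(* The mixture: K uniform on the family Ks, then b a uniform bijection K -> [m]. *)
Definition law_H1 (Ks : {set {set block n}}) (E : set 'M[R]_n) : \bar R :=
  (\sum_(K in Ks) (#|Ks|%:R^-1)%:E *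
     \sum_(b in bijections K) (#|bijections K|%:R^-1)%:E *
       gaussian_mx (signal_mean b) E)%E.

Definition risk (Ks : {set {set block n}}) (test : 'M[R]_n -> bool) : \bar R :=
  (law_H0 [set X | test X] + law_H1 Ks [set X | ~~ test X])%E.

Definition mu_det : R := \sum_l \sum_u \sum_v M l u v.

Definition sum_test (X : 'M[R]_n) : bool :=
  `|mu_det| / 2 <= Num.sg mu_det * \sum_i \sum_j X i j.

End model.

Section scan.
Variables (R : realType) (n k : nat) (delta : R) (Mmax : 'M[R]_k).

Definition normF2 (A : 'M[R]_k) : R := \sum_u \sum_v A u v ^+ 2.

Definition scan_stat (X : 'M[R]_n) (B : block n) : R :=
  \sum_(p in cells B) template_entry Mmax B p.1 p.2 * X p.1 p.2.

(* The maximum is taken in [\bar R], where the empty maximum is -oo. *)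
Definition scan_test (Bs : {set block n}) (tau : R) (X : 'M[R]_n) : bool :=
  (tau%:E <= \big[maxe/-oo]_(B in Bs) (scan_stat X B)%:E)%E.

Definition tau_all : R := Num.sqrt
  ((4 + delta) * normF2 Mmax * k%:R * ln (expR 1 * n%:R / k%:R)).

Definition tau_con : R := Num.sqrt ((4 + delta) * normF2 Mmax * ln n%:R).

End scan.

Definition little_omega (R : realType) (a b : nat -> R) : Prop :=
  (b : nat -> R^o) =o_\oo (a : nat -> R^o).

(* k if k > n/2, and 0 otherwise. When k <= n/2 one has log(n/k) >= log 2, so
   k log(n/k) and the scale k log(en/k) of [tau_all] are of the same order;
   when k/n -> 1 (which forces a single template) k log(n/k) is of smaller
   order, and vanishes at k = n. *)
Definition large_k (R : realType) (n k : nat) : R :=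
  if (n < 2 * k)%N then k%:R else 0.

(* Main.v *)
(* A linear statistic of the Gaussian matrix is controlled on both sides by
   Chernoff's bound, which follows from the product form of its moment
   generating function.  Under H_1 the blocks of a placement are disjoint, so
   the mean matrix is the sum of the placed templates: its entries add up to
   mu_det, and its inner product with the copy of M_max it contains is
   s = ||M_max||_F^2.  The sum test thus has risk at most
   2 exp (- mu_det^2 / (8 n^2)).  For the scan test, a union bound over at most
   exp (2 L) blocks and one lower tail at the block carrying M_max give risk at
   most 2 exp (- delta L / 2) once s >= 4 (4 + delta) L, where L >= log n is
   k log (en/k) or log n. *)
Require Import Defs.
From mathcomp Require Import all_boot all_order all_algebra.
From mathcomp Require Import all_classical all_reals all_analysis.
From mathcomp Require Import measurable_realfun ring lra.

Set Implicit Arguments.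
Unset Strict Implicit.
Unset Printing Implicit Defensive.

Import Order.TTheory GRing.Theory Num.Theory.
Import numFieldNormedType.Exports.

Local Open Scope classical_set_scope.
Local Open Scope ring_scope.

(** * Chernoff bounds for Gaussian matrices *)

Section normal_mgf.
Context (R : realType).
Local Notation mu := (@lebesgue_measure R).

(** The Radon-Nikodym derivative of the normal law has the same integral as [normal_pdf] over every
    measurable set, so the two agree almost everywhere. *)
Lemma ge0_integral_normal_prob (t : R) (f : R -> \bar R) :
  measurable_fun setT f -> (forall x, (0 <= f x)%E) ->
  (\int[normal_prob t 1]_x f x =
   \int[mu]_x (f x * (normal_pdf t 1 x)%:E))%E.
Proof.
move=> mf f0.
have dom := normal_prob_dominates t (1 : R).
rewrite -(Radon_Nikodym_SigmaFinite.change_of_variables dom)//.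
have mpdf : measurable_fun setT (fun x : measurableTypeR R => (normal_pdf t 1 x)%:E).
  by apply/measurable_EFinP; exact: measurable_normal_pdf.
apply: ae_eq_integral => //.
- apply: emeasurable_funM => //; apply: (measurable_int mu).
  exact: Radon_Nikodym_SigmaFinite.f_integrable.
- exact: emeasurable_funM.
- apply: ae_eqe_mul2l => /=; apply: integral_ae_eq => //.
  + exact: Radon_Nikodym_SigmaFinite.f_integrable.
  + by move=> E _ mE; rewrite -Radon_Nikodym_SigmaFinite.f_integral.
Qed.

(** Completing the square: the weight [expR (a * x)] turns the density of mean [t] into that of mean
    [t + a], up to a constant factor. *)
Lemma normal_mgf (t a : R) :
  (\int[normal_prob t 1]_x (expR (a * x))%:E = (expR (a * t + a ^+ 2 / 2))%:E)%E.
Proof.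
rewrite ge0_integral_normal_prob; last 2 first.
- by apply/measurable_EFinP; apply: measurableT_comp => //; exact: measurable_funM.
- by move=> x; rewrite lee_fin expR_ge0.
transitivity (\int[mu]_x ((expR (a * t + a ^+ 2 / 2))%:E * (normal_pdf (t + a) 1 x)%:E))%E.
  apply: eq_integral => x _; rewrite -!EFinM !normal_pdfE//=; congr (_%:E).
  rewrite !(mulrCA (expR _)); congr (_ * _).
  by rewrite /normal_fun -!expRD; congr expR; field.
rewrite ge0_integralZl//; last 2 first.
- by apply/measurable_EFinP; exact: measurable_normal_pdf.
- by move=> x _; rewrite lee_fin normal_pdf_ge0.
by rewrite integral_normal_pdf mule1.
Qed.

Lemma measurable_expR_lin N (a : 'I_N -> R) :
  measurable_fun setT (fun x : N.-tuple (measurableTypeR R) =>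
    (expR (\sum_i a i * tnth x i))%:E).
Proof.
apply/measurable_EFinP; apply: measurableT_comp => //.
apply: measurable_sum => i; apply: measurable_funM => //.
exact: measurable_tnth.
Qed.

(** Tonelli splits off the first coordinate, and induction handles the others. *)
Lemma product_law_mgf N (t a : 'I_N -> R) :
  (\int[product_law (fun i => normal_prob (t i) 1)]_x
     (expR (\sum_i a i * tnth x i))%:E =
   (expR (\sum_i (a i * t i + a i ^+ 2 / 2)))%:E)%E.
Proof.
elim: N t a => [|N IH] t a.
  rewrite /= integral_dirac//; last exact: measurable_expR_lin.
  by rewrite diracT mul1e !big_ord0.
rewrite /= ge0_integral_distribution; last 2 first.
- exact: measurable_expR_lin.
- by move=> x; rewrite lee_fin expR_ge0.
pose g (x : measurableTypeR R) (y : N.-tuple (measurableTypeR R)) : \bar R :=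
  ((expR (a ord0 * x))%:E * (expR (\sum_i a (lift ord0 i) * tnth y i))%:E)%E.
rewrite (eq_integral (fun z => g z.1 z.2)); last first.
  move=> [x y] _; rewrite /g /= big_ord_recl expRD; congr (_ * expR _)%:E.
  by apply: eq_bigr => i _; rewrite tnthS.
rewrite fubini_tonelli1//; last 2 first.
- apply: emeasurable_funM.
    apply/measurable_EFinP; apply: measurableT_comp => //.
    exact: measurable_funM.
  exact: (measurableT_comp (measurable_expR_lin (fun i => a (lift ord0 i)))).
- by move=> z; rewrite mule_ge0// lee_fin expR_ge0.
pose c := expR (\sum_i (a (lift ord0 i) * t (lift ord0 i) + a (lift ord0 i) ^+ 2 / 2)).
rewrite (eq_integral (fun x : measurableTypeR R => (expR (a ord0 * x))%:E * c%:E)%E); last first.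
  move=> x _; rewrite /fubini_F /g/= ge0_integralZl//; first by rewrite IH.
  exact: measurable_expR_lin.
rewrite ge0_integralZr//; last 2 first.
- by apply/measurable_EFinP; apply: measurableT_comp => //; exact: measurable_funM.
- by rewrite lee_fin expR_ge0.
by rewrite normal_mgf -EFinM -expRD big_ord_recl.
Qed.
End normal_mgf.

(** * Exponential moments and tails of linear statistics *)

Section gaussian_tail.
Context (R : realType) (n : nat).
Implicit Types (theta a X : 'M[R]_n).

(** The Frobenius inner product. The sum statistic and all scan statistics have this form with a
    fixed left argument. *)
Definition mx_dot a X : R := \sum_i \sum_j a i j * X i j.

Lemma mx_dotZl (c : R) a X : mx_dot (c *: a) X = c * mx_dot a X.
Proof.
rewrite /mx_dot mulr_sumr; apply: eq_bigr => i _.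
by rewrite mulr_sumr; apply: eq_bigr => j _; rewrite mxE mulrA.
Qed.

Lemma mx_dotZr (c : R) a X : mx_dot a (c *: X) = c * mx_dot a X.
Proof.
rewrite /mx_dot mulr_sumr; apply: eq_bigr => i _.
by rewrite mulr_sumr; apply: eq_bigr => j _; rewrite mxE mulrCA.
Qed.

Lemma mx_dot0r a : mx_dot a 0 = 0.
Proof. by rewrite /mx_dot big1// => i _; rewrite big1// => j _; rewrite mxE mulr0. Qed.

Lemma measurable_mx_dot a :
  measurable_fun setT (mx_dot a : 'M[measurableTypeR R]_n -> measurableTypeR R).
Proof.
apply: measurable_sum => i; apply: measurable_sum => j; apply: measurable_funM => //.
move=> _ B mB; rewrite setTI; apply: sub_sigma_algebra.
by exists i, j, B.
Qed.

Lemma gaussian_mx_mgf theta a :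
  (\int[gaussian_mx theta]_X (expR (mx_dot a X))%:E =
   (expR (mx_dot a theta + mx_dot a a / 2))%:E)%E.
Proof.
rewrite ge0_integral_distribution; last 2 first.
- by apply/measurable_EFinP; apply: measurableT_comp => //; exact: measurable_mx_dot.
- by move=> X; rewrite lee_fin expR_ge0.
have dotE X Y : mx_dot X Y = \sum_p mxvec X ord0 p * mxvec Y ord0 p.
  rewrite (reindex _ (curry_mxvec_bij n n))/= /mx_dot pair_bigA/=.
  by apply: eq_bigr => -[i j] _; rewrite /= !mxvecE.
rewrite (eq_integral (fun x : (n * n).-tuple (measurableTypeR R) =>
    (expR (\sum_p mxvec a ord0 p * tnth x p))%:E)); last first.
  move=> x _; rewrite /= dotE; congr (expR _)%:E.
  apply: eq_bigr => p _; congr (_ * _); case/mxvec_indexP: p => i j.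
  by rewrite mxvecE mxE.
rewrite product_law_mgf big_split/= !dotE mulr_suml.
by [].
Qed.

Lemma measurable_mx_dot_ge a (c : R) :
  measurable [set X : 'M[measurableTypeR R]_n | c <= mx_dot a X].
Proof.
rewrite -[X in measurable X]setTI.
by apply: measurable_fun_le => //; exact: measurable_mx_dot.
Qed.

(** Markov's inequality for [expR (l * mx_dot a X)] at [l = t / mx_dot a a], the minimiser of
    [l ^+ 2 * mx_dot a a / 2 - l * t]. *)
Lemma gaussian_mx_chernoff theta a (t : R) : 0 <= t -> 0 < mx_dot a a ->
  (gaussian_mx theta [set X | (mx_dot a theta + t <= mx_dot a X)%R] <=
   (expR (- (t ^+ 2 / (2 * mx_dot a a))))%:E)%E.
Proof.
move=> t0 a0; set s := mx_dot a a; set c := mx_dot a theta + t.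
have l0 : 0 <= t / s by rewrite divr_ge0// ltW.
set A := [set X | _].
have mA : measurable (A : set 'M[measurableTypeR R]_n).
  exact: measurable_mx_dot_ge.
have mexp : measurable_fun setT (fun X : 'M[measurableTypeR R]_n =>
    (expR (mx_dot (t / s *: a) X))%:E).
  by apply/measurable_EFinP; apply: measurableT_comp => //; exact: measurable_mx_dot.
rewrite -(setIT A) -integral_indic//.
apply: (@le_trans _ _ (\int[gaussian_mx theta]_X
    ((expR (- (t / s * c)))%:E * (expR (mx_dot (t / s *: a) X))%:E))%E).
  apply: ge0_le_integral => //.
  - exact/measurable_EFinP.
  - exact: emeasurable_funM.
  move=> X _; rewrite -EFinM lee_fin indicE mx_dotZl -expRD.
  (* On [A] the exponent is nonnegative; off [A] the indicator vanishes. *)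
  have [|_] := boolP (X \in A); last by rewrite expR_ge0.
  rewrite inE /A/= => cX; rewrite -expR0 ler_expR addrC subr_ge0.
  exact: ler_wpM2l.
rewrite ge0_integralZl//.
rewrite gaussian_mx_mgf -EFinM -expRD lee_fin ler_expR !mx_dotZl mx_dotZr.
rewrite -/s /c le_eqVlt; apply/orP; left; apply/eqP.
by have sN0 : s != 0 by [rewrite gt_eqF]; field.
Qed.
End gaussian_tail.

(** * Blocks, placements and the mean signal *)

(** [index] sends an element absent from [enum S] to the length [k] of the list, which [insub]
    rejects. *)
Lemma coord_notin n k (S : {set 'I_n}) i :
  #|S| = k -> i \notin S -> Defs.coord k S i = None.
Proof.
move=> <- iS; rewrite /Defs.coord insubF// cardE; apply/negbTE.
by rewrite -leqNgt leqNgt index_mem mem_enum.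
Qed.

Lemma coord_enum_val n (S : {set 'I_n}) (u : 'I_#|S|) :
  Defs.coord #|S| S (enum_val u) = Some u.
Proof.
have idx : index (enum_val u) (enum S) = u.
  by rewrite (enum_val_nth (enum_default u)) index_uniq ?enum_uniq// -cardE.
by rewrite /Defs.coord idx insubT// => ?; congr Some; exact: val_inj.
Qed.

(** On [S], [coord] inverts [enum_val]; off [S] it is [None], where [F] vanishes. *)
Lemma sum_coord (V : nmodType) n k (S : {set 'I_n}) (F : option 'I_k -> V) :
  #|S| = k -> F None = 0 -> \sum_i F (Defs.coord k S i) = \sum_u F (Some u).
Proof.
move=> cS; case: k / cS in F *; move=> F0.
rewrite (bigID (mem S))/= [X in _ + X]big1 ?addr0.
  by rewrite big_enum_val; apply: eq_bigr => u _; rewrite coord_enum_val.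
by move=> i iS; rewrite coord_notin.
Qed.

(** * Templates placed on a single block *)

Section template.
Variables (R : realType) (n k : nat).
Implicit Types (A : 'M[R]_k) (B : block n).

Lemma blocks_allP B : B \in blocks_all n k -> #|B.1| = k /\ #|B.2| = k.
Proof. by rewrite !inE => /andP[/eqP ? /eqP ?]. Qed.

(** Applied with [G = id] for the total mass and with squaring for the Frobenius norm; [G 0 = 0]
    removes the cells off the block. *)
Lemma sum_template_entry (G : R -> R) A B : G 0 = 0 -> B \in blocks_all n k ->
  \sum_i \sum_j G (template_entry A B i j) = \sum_u \sum_v G (A u v).
Proof.
move=> G0 /blocks_allP[B1 B2].
pose H o o' := G (if (o, o') is (Some u, Some v) then A u v else 0).
transitivity (\sum_u \sum_j H (Some u) (Defs.coord k B.2 j)).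
  rewrite -(sum_coord (F := fun o => \sum_j H o (Defs.coord k B.2 j)) B1)//.
  by rewrite big1.
by apply: eq_bigr => u _; rewrite (sum_coord (F := H (Some u)) B2).
Qed.

(** Padding the placed template by zeros turns a scan statistic into an inner product of n x n
    matrices. *)
Definition template_mx A B : 'M[R]_n := \matrix_(i, j) template_entry A B i j.

Lemma template_mx_notin A B i j : B \in blocks_all n k ->
  (i, j) \notin cells B -> template_mx A B i j = 0.
Proof.
move=> /blocks_allP[B1 B2]; rewrite inE negb_and mxE /template_entry/=.
by case/orP => [/(coord_notin B1) ->|/(coord_notin B2) ->] //; case: Defs.coord.
Qed.

Lemma scan_statE A (X : 'M[R]_n) B : B \in blocks_all n k ->
  scan_stat A X B = mx_dot (template_mx A B) X.
Proof.
move=> HB; rewrite /scan_stat /mx_dot pair_bigA/= big_mkcond; apply: eq_bigr => -[i j] _ /=.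
by case: ifPn => [_|ij]; [rewrite mxE|rewrite template_mx_notin// mul0r].
Qed.

Lemma mx_dot_template A B : B \in blocks_all n k ->
  mx_dot (template_mx A B) (template_mx A B) = normF2 A.
Proof.
move=> HB; rewrite /normF2 -(sum_template_entry (G := fun x => x ^+ 2) A _ HB) ?expr0n//.
by apply: eq_bigr => i _; apply: eq_bigr => j _; rewrite mxE expr2.
Qed.

End template.

(** * The mean matrix of a disjoint placement *)

Section signal.
Variables (R : realType) (n k m : nat) (M : 'I_m -> 'M[R]_k).
Variables (Bs : {set block n}) (K : {set block n}).
Hypothesis Bs_all : Bs \subset blocks_all n k.
Hypothesis K_pl : K \in placements m Bs.
Implicit Types b : {ffun {B : block n | B \in K} -> 'I_m}.

Lemma placement_all (B : block n) : B \in K -> B \in blocks_all n k.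
Proof.
move: K_pl; rewrite inE => /and3P[_ /fintype.subsetP KB _] /KB.
exact: (fintype.subsetP Bs_all).
Qed.

Lemma placement_mem (B : block n) : B \in K -> B \in Bs.
Proof. by move: K_pl; rewrite inE => /and3P[_ /fintype.subsetP KB _] /KB. Qed.

Lemma placement_disjoint (B B' : block n) p : B \in K -> B' \in K ->
  p \in cells B -> p \in cells B' -> B = B'.
Proof.
move=> BK BK' pB pB'; apply/eqP/negP => /negP BB'.
move: K_pl; rewrite inE => /and3P[_ _ /forall_inP/(_ _ BK)/forall_inP/(_ _ BK')].
by rewrite BB'/= => /pred0P/(_ p)/=; rewrite pB pB'.
Qed.

(** Disjointness leaves at most one block around each cell, so at most one term of the sum is
    nonzero there, that of the picked block. *)
Lemma signal_meanE b :
  signal_mean M b = \sum_(B : {B | B \in K}) template_mx (M (b B)) (val B).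
Proof.
apply/matrixP => i j; rewrite summxE mxE.
case: pickP => [B ijB|noB].
  rewrite (bigD1 B)//= mxE big1 ?addr0// => B' B'B.
  rewrite template_mx_notin ?placement_all ?(valP B')//.
  apply: contra B'B => ijB'; apply/eqP/val_inj.
  exact: placement_disjoint (valP B') (valP B) ijB' ijB.
rewrite big1// => B _; rewrite template_mx_notin ?placement_all ?(valP B)//.
by rewrite noB.
Qed.

(** Surjectivity bounds [m] by the size of the codomain, which injectivity equates with the number
    of blocks. *)
Lemma bijectionsP b : b \in bijections m K -> bijective b.
Proof.
rewrite inE => /andP[/injectiveP b_inj /forallP b_surj].
by apply: inj_card_bij => //; rewrite -(card_codom b_inj); apply/subset_leq_card/fintype.subsetP.
Qed.

Lemma sum_signal_mean b : b \in bijections m K ->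
  \sum_i \sum_j signal_mean M b i j = mu_det M.
Proof.
move=> /bijectionsP b_bij; rewrite signal_meanE /mu_det.
rewrite (reindex b)/=; last exact: onW_bij.
under eq_bigr do under eq_bigr do rewrite summxE.
under eq_bigr do rewrite exchange_big/=.
rewrite exchange_big/=; apply: eq_bigr => B _.
rewrite -(sum_template_entry (G := id) _ erefl (placement_all (valP B))).
by apply: eq_bigr => i _; apply: eq_bigr => j _; rewrite mxE.
Qed.

(** On the cells of [B] the mean is the template of [B] alone; elsewhere the left factor is zero. *)
Lemma mx_dot_template_signal b (B : {B | B \in K}) :
  mx_dot (template_mx (M (b B)) (val B)) (signal_mean M b) = normF2 (M (b B)).
Proof.
rewrite -(mx_dot_template _ (placement_all (valP B))).
apply: eq_bigr => i _; apply: eq_bigr => j _.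
have [ijB|ijB] := boolP ((i, j) \in cells (val B)); last first.
  by rewrite template_mx_notin ?mul0r// placement_all// (valP B).
congr (_ * _); rewrite [LHS]mxE; case: pickP => [B' ijB'|/(_ B)]; last by rewrite ijB.
suff -> : B' = B by rewrite mxE.
by apply/val_inj; exact: placement_disjoint (valP B') (valP B) ijB' ijB.
Qed.

End signal.

(** * Interval lengths and the number of blocks in each family *)

Section intervals.
Variables n k : nat.
Hypothesis k_le_n : (k <= n)%N.

(** The map [l |-> (i + l) %% n] is injective on [l < k] because [k <= n]. *)
Lemma card_circular_interval (i : 'I_n) : #|circular_interval n k i| = k.
Proof.
have n0 : (0 < n)%N by exact: leq_ltn_trans (ltn_ord i).
pose f (l : 'I_k) : 'I_n := Ordinal (ltn_pmod (i + l) n0).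
have -> : circular_interval n k i = [set f l | l : 'I_k]%SET.
  apply/setP => j; rewrite inE; apply/existsP/imsetP => [[l /eqP jl]|[l _ ->]].
    by exists l => //; exact: val_inj.
  by exists l.
rewrite card_imset ?card_ord// => l l' /(congr1 val)/= /eqP.
rewrite eqn_modDl !modn_small ?(leq_trans (ltn_ord _))// => /eqP.
exact: val_inj.
Qed.

(** An interval that ends by [n] does not wrap around, so standard intervals inherit the cardinality
    of circular ones. *)
Lemma con_intervalE (i : nat) : (i + k <= n)%N ->
  con_interval n k i = circular_interval n k i.
Proof.
move=> ikn; apply/setP => j; rewrite !inE; apply/idP/existsP => [/andP[ij jik]|].
  have lk : (j - i < k)%N by rewrite ltn_subLR.
  by exists (Ordinal lk); rewrite /= subnKC// modn_small.
move=> [l /eqP ->].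
have il : (i + l < i + k)%N by rewrite ltn_add2l.
by rewrite modn_small ?(leq_trans il)// leq_addr.
Qed.

Lemma blocks_circ_sub : blocks_circ n k \subset blocks_all n k.
Proof.
apply/fintype.subsetP => B; rewrite !inE => /andP[/imsetP[i _ ->] /imsetP[j _ ->]].
by rewrite !card_circular_interval eqxx.
Qed.

Lemma card_con_interval i : (0 < k)%N -> (i + k <= n)%N -> #|con_interval n k i| = k.
Proof.
move=> k0 ikn; rewrite con_intervalE//.
have ltin : (i < n)%N by apply: leq_trans ikn; rewrite -addn1 leq_add2l.
exact: (card_circular_interval (Ordinal ltin)).
Qed.

Lemma blocks_con_sub : (0 < k)%N -> blocks_con n k \subset blocks_all n k.
Proof.
move=> k0; have ikn (i : 'I_(n - k).+1) : (i + k <= n)%N.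
  by have := ltn_ord i; rewrite ltnS leq_subRL// addnC.
apply/fintype.subsetP => B; rewrite !inE => /andP[/imsetP[i _ ->] /imsetP[j _ ->]].
by rewrite !card_con_interval ?eqxx ?ikn.
Qed.

(** Only a bound, since distinct starting points can give the same interval, as at [k = n]. *)
Lemma card_blocks_circ : (#|blocks_circ n k| <= n ^ 2)%N.
Proof.
by rewrite cardsX leq_mul// (leq_trans (leq_imset_card _ _))// card_ord.
Qed.

Lemma card_blocks_con : (0 < k)%N -> (#|blocks_con n k| <= n ^ 2)%N.
Proof.
(* There are [n - k + 1] starting points, hence at most [n] because [k] is positive. *)
move=> k0; have nk : ((n - k).+1 <= n)%N by rewrite ltn_subrL k0 (leq_trans k0).
by rewrite cardsX leq_mul// (leq_trans (leq_imset_card _ _))// card_ord.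
Qed.

Lemma card_blocks_all : #|blocks_all n k| = ('C(n, k) ^ 2)%N.
Proof. by rewrite cardsX card_draws card_ord. Qed.

End intervals.

(** * Risk bounds *)

Section risk_bounds.
Variables (R : realType) (n : nat).
Local Notation Mn := 'M[measurableTypeR R]_n.

Lemma le_gaussian_mx (theta : 'M[R]_n) (E F : set 'M[R]_n) :
  measurable (E : set Mn) -> measurable (F : set Mn) -> E `<=` F ->
  (gaussian_mx theta E <= gaussian_mx theta F)%E.
Proof. by move=> mE mF EF; rewrite le_measure ?inE. Qed.

Lemma measurable_negb (f : 'M[R]_n -> bool) :
  measurable ([set X | f X] : set Mn) -> measurable ([set X | ~~ f X] : set Mn).
Proof.
move=> mf; rewrite (_ : [set X | ~~ f X] = ~` [set X | f X] :> set Mn).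
  exact: measurableC.
by apply/seteqP; split => X /= /negP.
Qed.

(** The upper tail in the direction [- a]. *)
Lemma gaussian_mx_chernoff_lower (theta a : 'M[R]_n) (t : R) :
  0 <= t -> 0 < mx_dot a a ->
  (gaussian_mx theta [set X | ~~ (mx_dot a theta - t <= mx_dot a X)%R] <=
   (expR (- (t ^+ 2 / (2 * mx_dot a a))))%:E)%E.
Proof.
move=> t0 a0.
have dotN X : mx_dot (- a) X = - mx_dot a X by rewrite -scaleN1r mx_dotZl mulN1r.
have dotNN : mx_dot (- a) (- a) = mx_dot a a.
  by rewrite dotN -[X in mx_dot a X]scaleN1r mx_dotZr mulN1r opprK.
rewrite -dotNN; apply: le_trans (gaussian_mx_chernoff theta t0 _); last by rewrite dotNN.
apply: le_gaussian_mx.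
- by apply: measurable_negb; exact: measurable_mx_dot_ge.
- exact: measurable_mx_dot_ge.
by move=> X /=; rewrite -ltNge !dotN; lra.
Qed.

(** Uniform weights add up to 1, or to 0 on an empty set, where [0 <= c] is what remains. The bound
    serves both layers of the mixture, over [K] and over [b]. *)
Lemma mean_le (I : finType) (A : {set I}) (f : I -> \bar R) (c : R) :
  0 <= c -> (forall i, i \in A -> (f i <= c%:E)%E) ->
  (\sum_(i in A) (#|A|%:R^-1)%:E * f i <= c%:E)%E.
Proof.
move=> c0 fc; apply: (@le_trans _ _ (\sum_(i in A) (#|A|%:R^-1 * c)%:E)%E).
  by apply: lee_sum => i iA; rewrite EFinM lee_wpmul2l ?fc// lee_fin invr_ge0.
rewrite sumEFin lee_fin sumr_const -(mulr_natl (_ * c)) mulrA.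
have [->|A0] := eqVneq #|A| 0; first by rewrite !mul0r.
by rewrite mulfV ?mul1r// pnatr_eq0.
Qed.

Section law_H1.
Variables (k m : nat) (M : 'I_m -> 'M[R]_k) (Ks : {set {set block n}}).

Lemma law_H1_le (E : set 'M[R]_n) (c : R) : 0 <= c ->
  (forall (K : {set block n}) (b : {ffun {B : block n | B \in K} -> 'I_m}), K \in Ks ->
    b \in bijections m K -> (gaussian_mx (signal_mean M b) E <= c%:E)%E) ->
  (law_H1 M Ks E <= c%:E)%E.
Proof.
move=> c0 Ec; apply: mean_le => // K KKs.
by apply: mean_le => // b bK; exact: Ec.
Qed.

Lemma risk_ge0 (test : 'M[R]_n -> bool) : (0 <= risk M Ks test)%E.
Proof.
rewrite adde_ge0 ?measure_ge0//; apply: sume_ge0 => K _.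
rewrite mule_ge0 ?lee_fin ?invr_ge0//; apply: sume_ge0 => b _.
by rewrite mule_ge0 ?lee_fin ?invr_ge0 ?measure_ge0.
Qed.
End law_H1.

Section family.
Variables (k m : nat) (M : 'I_m -> 'M[R]_k) (Bs : {set block n}).
Hypothesis Bs_all : Bs \subset blocks_all n k.

(** Both errors are deviations by [|mu| / 2]: along the constant sign matrix the statistic has mean
    0 under H_0 and mean [|mu|] under every component of H_1. *)
Lemma risk_sum_le : (0 < n)%N -> mu_det M != 0 ->
  (risk M (placements m Bs) (@sum_test R n _ _ M) <=
   (2 * expR (- (mu_det M ^+ 2 / (8 * n%:R ^+ 2))))%:E)%E.
Proof.
move=> n0 mu0; set mu := mu_det M; pose a : 'M[R]_n := const_mx (Num.sg mu).
have dota X : mx_dot a X = Num.sg mu * \sum_i \sum_j X i j.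
  rewrite /mx_dot mulr_sumr; apply: eq_bigr => i _.
  by rewrite mulr_sumr; apply: eq_bigr => j _; rewrite mxE.
(* The squared sign is 1 since [mu] is nonzero, so the statistic has variance [n ^ 2]. *)
have aa : mx_dot a a = n%:R ^+ 2.
  rewrite dota (eq_bigr (fun=> n%:R * Num.sg mu)) => [|i _].
    rewrite sumr_const card_ord -(mulr_natl (_ * _)) mulrCA.
    by rewrite (mulrCA (Num.sg mu)) -expr2 sqr_sg mu0 mulr1.
  by under eq_bigr do rewrite mxE; rewrite sumr_const card_ord mulr_natl.
have aa0 : 0 < mx_dot a a by rewrite aa exprn_gt0// ltr0n.
have t0 : 0 <= `|mu| / 2 by rewrite divr_ge0.
have testE : @sum_test R n _ _ M = fun X => `|mu| / 2 <= mx_dot a X.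
  by apply/funext => X; rewrite dota.
have expE : (`|mu| / 2) ^+ 2 / (2 * mx_dot a a) = mu ^+ 2 / (8 * n%:R ^+ 2).
  rewrite aa exprMn real_normK ?num_real//.
  have n0' : n%:R != 0 :> R by rewrite pnatr_eq0 -lt0n.
  by field.
rewrite -expE mulr_natl mulr2n EFinD; apply: leeD.
  rewrite testE; have := gaussian_mx_chernoff 0 t0 aa0.
  by rewrite mx_dot0r add0r.
apply: law_H1_le => [|K b K_pl b_bij]; first exact: expR_ge0.
rewrite testE; have := gaussian_mx_chernoff_lower (signal_mean M b) t0 aa0.
rewrite dota (sum_signal_mean M Bs_all K_pl b_bij) -/mu -normrEsg.
by rewrite (_ : `|mu| - `|mu| / 2 = `|mu| / 2)//; field.
Qed.

Lemma scan_testP (A : 'M[R]_k) tau (X : 'M[R]_n) :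
  reflect (exists2 B, B \in Bs & tau <= mx_dot (template_mx A B) X)
          (scan_test A Bs tau X).
Proof.
(* A real threshold is never at most the default [-oo], so the first alternative is void. *)
apply: (iffP (bigmax_geP _ _ _ _)) => [[//|[B BBs]]|[B BBs tauB]].
  rewrite lee_fin scan_statE ?(fintype.subsetP Bs_all)// => tauB; by exists B.
by right; exists B; rewrite // lee_fin scan_statE ?(fintype.subsetP Bs_all).
Qed.

(** The rejection region as a finite union of half-spaces gives both its measurability and the union
    bound. *)
Lemma scan_test_bigcup (A : 'M[R]_k) tau :
  [set X : 'M[R]_n | scan_test A Bs tau X] =
  \bigcup_(B in [set` enum Bs]) [set X | tau <= mx_dot (template_mx A B) X].
Proof.
apply/seteqP; split => [X /scan_testP[B BBs tauB]|X [B]]/=.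
  by exists B; rewrite //= mem_enum.
by rewrite mem_enum => BBs tauB; apply/scan_testP; exists B.
Qed.

Lemma measurable_scan_test (A : 'M[R]_k) tau :
  measurable ([set X | scan_test A Bs tau X] : set Mn).
Proof.
rewrite scan_test_bigcup; apply: fin_bigcup_measurable => // B _.
exact: measurable_mx_dot_ge.
Qed.

(** Every scan statistic has variance [s]. Under H_0 a union bound applies. Under H_1 the block
    carrying [M l] has mean [s], and a miss forces its statistic more than [s - tau] below that
    mean. *)
Lemma risk_scan_le (l : 'I_m) (tau : R) : let s := normF2 (M l) in
  0 < s -> 0 <= tau <= s ->
  (risk M (placements m Bs) (scan_test (M l) Bs tau) <=
   (#|Bs|%:R * expR (- (tau ^+ 2 / (2 * s))) +
    expR (- ((s - tau) ^+ 2 / (2 * s))))%:E)%E.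
Proof.
move=> s s0 /andP[tau0 taus]; rewrite EFinD; apply: leeD.
  rewrite /law_H0 scan_test_bigcup.
  set A_ := fun B => [set X | tau <= mx_dot (template_mx (M l) B) X].
  have mA B : measurable (A_ B : set Mn) by exact: measurable_mx_dot_ge.
  apply: (@le_trans _ _ (\sum_(B \in [set` enum Bs]) gaussian_mx 0 (A_ B))%E).
    by apply: content_sub_fsum => //; apply: fin_bigcup_measurable => // B _; exact: mA.
  rewrite -(@fsbig_seq _ _ (GRing.add : Monoid.com_law _) _ (enum Bs)) ?enum_uniq//.
  rewrite big_enum/=.
  apply: (@le_trans _ _ (\sum_(B in Bs) (expR (- (tau ^+ 2 / (2 * s))))%:E)%E).
    apply: lee_sum => B BBs; have BA := fintype.subsetP Bs_all _ BBs.
    have := @gaussian_mx_chernoff R n 0 (template_mx (M l) B) _ tau0.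
    by rewrite mx_dot_template// mx_dot0r add0r; apply.
  by rewrite sumEFin lee_fin sumr_const -(mulr_natl (expR _)).
apply: law_H1_le => [|K b K_pl b_bij]; first exact: expR_ge0.
have [g _ gK] := bijectionsP b_bij; pose B := g l.
have BA := placement_all Bs_all K_pl (valP B).
pose T := template_mx (M l) (val B).
have TT : mx_dot T T = s by rewrite mx_dot_template.
have Ts : mx_dot T (signal_mean M b) = s.
  by have := mx_dot_template_signal M Bs_all K_pl b B; rewrite gK.
have st0 : 0 <= s - tau by rewrite subr_ge0.
have := gaussian_mx_chernoff_lower (signal_mean M b) st0 (_ : 0 < mx_dot T T).
rewrite TT Ts subKr => /(_ s0); apply: le_trans; apply: le_gaussian_mx.
- by apply: measurable_negb; exact: measurable_scan_test.
- by apply: measurable_negb; exact: measurable_mx_dot_ge.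
move=> X /=; apply: contra => tauX; apply/scan_testP.
by exists (val B); rewrite // (placement_mem K_pl (valP B)).
Qed.

(* With threshold [sqrt ((4 + delta) s L)], a family of at most [exp (2 L)]
   blocks leaves the slack [delta / 2 * L] in the union bound. *)
Lemma risk_scan_le_expR (l : 'I_m) (delta L : R) : let s := normF2 (M l) in
  0 < delta -> 0 < L -> #|Bs|%:R <= expR (2 * L) -> 4 * (4 + delta) * L <= s ->
  (risk M (placements m Bs) (scan_test (M l) Bs (Num.sqrt ((4 + delta) * s * L))) <=
   (2 * expR (- (delta / 2 * L)))%:E)%E.
Proof.
move=> s d0 L0 cBs Ls; set tau := Num.sqrt _.
have dL0 : 0 < delta * L by rewrite mulr_gt0.
have s0 : 0 < s by lra.
have tau2 : tau ^+ 2 = (4 + delta) * s * L.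
  by rewrite sqr_sqrtr// !mulr_ge0//; lra.
have tau0 : 0 <= tau by exact: sqrtr_ge0.
(* The assumption on [s] gives [tau ^+ 2 = (4 + delta) * s * L <= s ^+ 2 / 4]. *)
have taus : tau <= s / 2.
  rewrite -(@ler_pXn2r _ 2) ?nnegrE//; last by lra.
  have : 4 * (4 + delta) * L * s <= s * s by rewrite ler_wpM2r// ltW.
  by rewrite tau2; lra.
apply: le_trans (risk_scan_le s0 _) _.
  by rewrite tau0/= -/s; lra.
rewrite -/s tau2 lee_fin [leRHS]mulr_natl [leRHS]mulr2n; apply: lerD.
  (* The exponent of the union bound is [2 * L - (4 + delta) * L / 2 = - (delta / 2 * L)]. *)
  apply: le_trans (ler_wpM2r (expR_ge0 _) cBs) _.
  rewrite -expRD ler_expR.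
  have -> : (4 + delta) * s * L / (2 * s) = (4 + delta) * L / 2.
    by have sN0 : s != 0 by [rewrite gt_eqF]; field.
  by lra.
(* Since [s - tau >= s / 2], the exponent of the lower tail is at least
   [s / 8 >= (4 + delta) * L / 2] in absolute value. *)
rewrite ler_expR lerN2 ler_pdivlMr ?mulr_gt0//.
have : s / 2 * (s / 2) <= (s - tau) ^+ 2 by rewrite expr2 ler_pM//; lra.
have : 4 * (4 + delta) * L * s <= s * s by rewrite ler_wpM2r// ltW.
have : 0 < L * s by rewrite mulr_gt0.
by lra.
Qed.

End family.
End risk_bounds.

(** * Asymptotics *)

Section asymptotics.
Variable R : realType.

(** The bound at [e = 1] makes the values eventually finite, which reduces the claim to real
    convergence. *)
Lemma cvge0_le (u : nat -> \bar R) : (forall n, 0 <= u n)%E ->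
  (forall e : R, 0 < e -> \forall n \near \oo, (u n <= e%:E)%E) ->
  u n @[n --> \oo] --> 0%E.
Proof.
move=> u0 ue; have ufin : \forall n \near \oo, u n \is a fin_num.
  apply: filterS (ue 1 ltr01) => n un.
  by rewrite fin_numElt (lt_le_trans _ (u0 n))// (le_lt_trans un)// ltry.
apply/fine_cvgP; split => //; apply/cvgr0Pnorm_le => e e0.
apply: filterS2 ufin (ue e e0) => n fn un /=.
by rewrite ger0_norm ?fine_ge0// -lee_fin fineK.
Qed.

(** The classical bound [(e n / k) ^ k], from [n ^_ k <= n ^ k] and [k ^ k / k! <= e ^ k]. *)
Lemma bin_le_expR n k : (0 < k <= n)%N ->
  ('C(n, k))%:R <= expR (k%:R * ln (expR 1 * n%:R / k%:R)) :> R.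
Proof.
case: k => // k /andP[_ kn].
have k0 : 0 < k.+1%:R :> R by [].
have n0 : 0 < n%:R :> R by rewrite ltr0n (leq_trans _ kn).
rewrite expRM_natl lnK ?posrE ?divr_gt0 ?mulr_gt0 ?expR_gt0//.
rewrite -mulrA exprMn -expRM_natl mulr1 expr_div_n.
have fact0 : 0 < (k.+1)`!%:R :> R by rewrite ltr0n fact_gt0.
(* The left side is a single term of the exponential series. *)
have e_ge : k.+1%:R ^+ k.+1 / (k.+1)`!%:R <= expR k.+1%:R :> R.
  apply: le_trans (expR_ge1Dxn k (ltW k0)); by rewrite lerDr.
apply: le_trans (ler_wpM2r _ e_ge); last by rewrite divr_ge0// exprn_ge0// ltW.
have kk0 : k.+1%:R ^+ k.+1 != 0 :> R by rewrite expf_eq0/= gt_eqF.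
rewrite [leRHS]mulrC mulrA divfK//.
rewrite ler_pdivlMr// -natrM -natrX ler_nat bin_ffact.
by elim: k.+1 => // j IH; rewrite ffactnSr expnSr leq_mul// leq_subr.
Qed.

Lemma ln_eM (x : R) : 0 < x -> ln (expR 1 * x) = 1 + ln x.
Proof. by move=> x0; rewrite lnM ?posrE ?expR_gt0// expRK. Qed.

(** The scale is [k + k ln (n / k)], whose terms dominate [ln k] and [ln (n / k)]. Hence it diverges
    with [n], even for bounded [k]. *)
Lemma scan_scale_ge_ln n k : (0 < k <= n)%N ->
  ln n%:R <= k%:R * ln (expR 1 * n%:R / k%:R) :> R.
Proof.
move=> /andP[k0 kn].
have k0' : 0 < k%:R :> R by rewrite ltr0n.
have k1 : 1 <= k%:R :> R by rewrite ler1n.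
have nk1 : 1 <= n%:R / k%:R :> R by rewrite ler_pdivlMr// mul1r ler_nat.
have nk0 : 0 < n%:R / k%:R :> R by exact: lt_le_trans nk1.
have -> : ln n%:R = ln k%:R + ln (n%:R / k%:R) :> R.
  by rewrite -lnM ?posrE// mulrC divfK// gt_eqF.
rewrite -mulrA ln_eM//.
rewrite mulrDr mulr1 lerD//; first exact/ltW/ln_sublinear.
by rewrite ler_peMl// ln_ge0.
Qed.

(** From [exp (-1/2) >= 1 - 1/2], by inversion. *)
Lemma ln2_ge_half : 2^-1 <= ln 2 :> R.
Proof.
rewrite -ler_expR lnK ?posrE// -[X in _ <= X]invrK -[leLHS]invrK -expRN.
rewrite lef_pV2 ?posrE ?expR_gt0// ?invr_gt0//.
by apply: le_trans (expR_ge1Dx _); lra.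
Qed.

(* For k <= n/2, [ln (n / k) >= 1/2] turns the linear term of
   [k ln (en/k) = k + k ln (n/k)] into [2 k ln (n/k)]. *)
Lemma scan_scale_le n k : (0 < k <= n)%N ->
  k%:R * ln (expR 1 * n%:R / k%:R) <=
  3 * (k%:R * ln (n%:R / k%:R)) + large_k R n k :> R.
Proof.
move=> /andP[k0 kn].
have k0' : 0 < k%:R :> R by rewrite ltr0n.
have nk1 : 1 <= n%:R / k%:R :> R by rewrite ler_pdivlMr// mul1r ler_nat.
have nk0 : 0 < n%:R / k%:R :> R by exact: lt_le_trans nk1.
have kln0 : 0 <= k%:R * ln (n%:R / k%:R) :> R by rewrite mulr_ge0 ?ln_ge0// ltW.
(* When [k > n / 2], [large_k] is exactly the linear term [k]. *)
rewrite -mulrA ln_eM// mulrDr mulr1 /large_k; case: ltnP => kn2; first by lra.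
have nk2 : 2 <= n%:R / k%:R :> R by rewrite ler_pdivlMr// -natrM ler_nat.
have lnnk : 2^-1 <= ln (n%:R / k%:R) :> R.
  by apply: le_trans ln2_ge_half _; rewrite ler_ln ?posrE.
have : k%:R * 2^-1 <= k%:R * ln (n%:R / k%:R) :> R by rewrite ler_wpM2l// ltW.
by lra.
Qed.

(** * Vanishing risk along a sequence of block families *)

Section families.
Variables (m k : nat -> nat) (M : forall n, 'I_(m n) -> 'M[R]_(k n)).
Arguments M : clear implicits.
Variable Bs : forall n, {set block n}.
(** The inclusion is asked only eventually because the consecutive families need [k n <= n], which
    fails at [n = 0] for positive [k]. *)
Hypothesis Bs_all : \forall n \near \oo, Bs n \subset blocks_all n (k n).

Lemma risk_sum_cvg0 :
  little_omega (fun n => `|mu_det (M n)|) (fun n => n%:R : R) ->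
  risk (M n) (placements (m n) (Bs n)) (@sum_test R n _ _ (M n)) @[n --> \oo] --> 0%E.
Proof.
move=> /eqoP mu_big; apply: cvge0_le => [n|e e0]; first exact: risk_ge0.
(* From [n <= d * |mu|] and [d <= 1], the exponent [x] is at least [1 / (8 d)]; then
   [expR (- x) <= 1 / x <= 8 d], and twice this is at most [e]. *)
pose d := Num.min 1 (e / 16).
have d0 : 0 < d by rewrite lt_min ltr01 divr_gt0.
have d1 : d <= 1 by rewrite ge_min lexx.
have de : d <= e / 16 by rewrite ge_min lexx orbT.
near=> n.
have n0 : (0 < n)%N by near: n; exact: nbhs_infty_gt.
have n0' : 0 < n%:R :> R by rewrite ltr0n.
have nmu : n%:R <= d * `|mu_det (M n)|.
  have : `|n%:R : R^o| <= d * `| `|mu_det (M n)| : R^o| by near: n; exact: mu_big.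
  by rewrite normr_id ger0_norm.
have mu0 : mu_det (M n) != 0.
  by apply/eqP => mu0; move: nmu; rewrite mu0 normr0 mulr0 leNgt n0'.
have BsA : Bs n \subset blocks_all n (k n) by near: n.
apply: le_trans (risk_sum_le BsA n0 mu0) _; rewrite lee_fin.
set x := mu_det (M n) ^+ 2 / (8 * n%:R ^+ 2).
have n2 : n%:R ^+ 2 <= d * mu_det (M n) ^+ 2.
  have : n%:R * n%:R <= (d * `|mu_det (M n)|) * (d * `|mu_det (M n)|).
    by rewrite ler_pM// ltW.
  rewrite -expr2 mulrACA -!expr2 real_normK ?num_real// => /le_trans; apply.
  by rewrite ler_wpM2r ?sqr_ge0// expr2 ler_piMl// ltW.
have dx : 1 <= 8 * d * x.
  rewrite /x mulrA ler_pdivlMr ?mulr_gt0 ?exprn_gt0// mul1r -mulrA.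
  by rewrite ler_wpM2l.
have xexp : x <= expR x by apply: le_trans (expR_ge1Dx x); rewrite lerDr.
have : expR (- x) <= 8 * d.
  rewrite expRN -[leLHS]mul1r ler_pdivrMr ?expR_gt0//.
  by apply: le_trans dx _; rewrite ler_wpM2l// mulr_ge0// ltW.
by lra.
Unshelve. all: by end_near. Qed.

Lemma risk_scan_cvg0 (l : forall n, 'I_(m n)) (delta : R) (L : nat -> R) :
  0 < delta ->
  (\forall n \near \oo, [/\ ln n%:R <= L n, #|Bs n|%:R <= expR (2 * L n) &
     4 * (4 + delta) * L n <= normF2 (M n (l n))]) ->
  risk (M n) (placements (m n) (Bs n))
    (scan_test (M n (l n)) (Bs n)
       (Num.sqrt ((4 + delta) * normF2 (M n (l n)) * L n))) @[n --> \oo] --> 0%E.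
Proof.
move=> delta0 HL; apply: cvge0_le => [n|e e0]; first exact: risk_ge0.
near=> n.
have [lnL cBs Ls] : [/\ ln n%:R <= L n, #|Bs n|%:R <= expR (2 * L n) &
     4 * (4 + delta) * L n <= normF2 (M n (l n))] by near: n.
have BsA : Bs n \subset blocks_all n (k n) by near: n.
have n1 : 1 < n%:R :> R by near: n; exact: nbhs_infty_gtr.
have L0 : 0 < L n by apply: lt_le_trans lnL; rewrite ln_gt0.
apply: le_trans (risk_scan_le_expR BsA delta0 L0 cBs Ls) _; rewrite lee_fin.
(* The value of [L] at which the risk bound equals [e]. *)
pose x := 2 / delta * ln (2 / e).
have nx : expR x <= n%:R by near: n; exact: nbhs_infty_ger.
have xL : x <= L n.
  apply: le_trans lnL; rewrite -ler_expR lnK// posrE; exact: lt_trans n1.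
have dx : delta / 2 * x = ln (2 / e).
  by rewrite /x mulrA; have d0 : delta != 0 by [rewrite gt_eqF]; field.
have : expR (- (delta / 2 * L n)) <= expR (- (delta / 2 * x)).
  by rewrite ler_expR lerN2 ler_wpM2l// ltW// divr_gt0.
by rewrite dx [X in _ <= X]expRN lnK ?posrE ?divr_gt0// invf_div; lra.
Unshelve. all: by end_near. Qed.

End families.
End asymptotics.

(** * Sum and scan tests on the three concrete placement families *)

Theorem theorem1 (R : realType) (m k : nat -> nat)
  (m_gt0 : forall n, (0 < m n)%N) (k_gt0 : forall n, (0 < k n)%N)
  (mk_le : forall n, (0 < n)%N -> (m n * k n <= n)%N)
  (M : forall n, 'I_(m n) -> 'M[R]_(k n))
  (lmax : forall n, 'I_(m n))
  (lmax_argmax : forall n (l : 'I_(m n)),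
     normF2 (M n l) <= normF2 (M n (lmax n)))
  (delta : R) (delta_gt0 : 0 < delta) :
  let Mmax := fun n => M n (lmax n) in
  let K_all := fun n => placements (m n) (blocks_all n (k n)) in
  let K_con := fun n => placements (m n) (blocks_con n (k n)) in
  let K_circ := fun n => placements (m n) (blocks_circ n (k n)) in
  let scan_all := fun n => scan_test (Mmax n) (blocks_all n (k n))
                             (tau_all n delta (Mmax n)) in
  let scan_con := fun n => scan_test (Mmax n) (blocks_con n (k n))
                             (tau_con n delta (Mmax n)) in
  let scan_circ := fun n => scan_test (Mmax n) (blocks_circ n (k n))
                             (tau_con n delta (Mmax n)) in
  [/\ little_omega (fun n => `|mu_det (M n)|) (fun n => n%:R) ->
      [/\ risk (M n) (K_all n) (@sum_test R n _ _ (M n)) @[n --> \oo] --> 0%E,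
          risk (M n) (K_con n) (@sum_test R n _ _ (M n)) @[n --> \oo] --> 0%E &
          risk (M n) (K_circ n) (@sum_test R n _ _ (M n)) @[n --> \oo] --> 0%E],

      little_omega (fun n => normF2 (Mmax n))
                   (fun n => (k n)%:R * ln (n%:R / (k n)%:R)) ->
      little_omega (fun n => normF2 (Mmax n)) (fun n => large_k R n (k n)) ->
      risk (M n) (K_all n) (scan_all n) @[n --> \oo] --> 0%E &

      little_omega (fun n => normF2 (Mmax n)) (fun n => ln n%:R) ->
      risk (M n) (K_con n) (scan_con n) @[n --> \oo] --> 0%E /\
      risk (M n) (K_circ n) (scan_circ n) @[n --> \oo] --> 0%E].
Proof.
move=> Mmax K_all K_con K_circ scan_all scan_con scan_circ.
have kn n : (0 < n)%N -> (0 < k n <= n)%N.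
  by move=> n0; rewrite k_gt0 (leq_trans _ (mk_le n n0))// leq_pmull.
have all_sub : \forall n \near \oo, blocks_all n (k n) \subset blocks_all n (k n).
  by near=> n.
have con_sub : \forall n \near \oo, blocks_con n (k n) \subset blocks_all n (k n).
  near=> n; have /andP[_ kn'] : (0 < k n <= n)%N by apply: kn; near: n; exact: nbhs_infty_gt.
  exact: blocks_con_sub.
have circ_sub : \forall n \near \oo, blocks_circ n (k n) \subset blocks_all n (k n).
  near=> n; have /andP[_ kn'] : (0 < k n <= n)%N by apply: kn; near: n; exact: nbhs_infty_gt.
  exact: blocks_circ_sub.
have s_ge0 n : 0 <= normF2 (Mmax n).
  by apply: sumr_ge0 => u _; apply: sumr_ge0 => v _; exact: sqr_ge0.
split.
- by move=> mu_big; split; exact: risk_sum_cvg0.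
- move=> /eqoP s_kln /eqoP s_large.
  pose L n := (k n)%:R * ln (expR 1 * n%:R / (k n)%:R) : R.
  have tauE n : tau_all n delta (Mmax n) = Num.sqrt ((4 + delta) * normF2 (Mmax n) * L n).
    by rewrite /tau_all mulrA.
  rewrite /scan_all; under eq_cvg do rewrite tauE.
  apply: risk_scan_cvg0 => //.
  (* The scale satisfies [L <= 3 d s + d s = 4 d s] with [s] the squared norm of [Mmax], and
     [4 * (4 + delta) * 4 d = 1]. *)
  pose d := (16 * (4 + delta))^-1.
  have d0 : 0 < d by rewrite invr_gt0; lra.
  near=> n.
  have kn' : (0 < k n <= n)%N by apply: kn; near: n; exact: nbhs_infty_gt.
  split; first exact: scan_scale_ge_ln.
    (* Rows and columns contribute one binomial factor each, hence the [2] in [expR (2 * L)]. *)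
    rewrite card_blocks_all natrX expRM_natl.
    by rewrite lerXn2r ?nnegrE ?expR_ge0// bin_le_expR.
  have h1 : (k n)%:R * ln (n%:R / (k n)%:R) <= d * normF2 (Mmax n).
    apply: le_trans (ler_norm _) _; rewrite -[X in d * X]ger0_norm//.
    by near: n; exact: s_kln.
  have h2 : large_k R n (k n) <= d * normF2 (Mmax n).
    apply: le_trans (ler_norm _) _; rewrite -[X in d * X]ger0_norm//.
    by near: n; exact: s_large.
  have L4 : L n <= 4 * d * normF2 (Mmax n).
    by apply: le_trans (scan_scale_le R kn') _; lra.
  have dE : 4 * (4 + delta) * (4 * d * normF2 (Mmax n)) = normF2 (Mmax n).
    by rewrite /d; field; rewrite gt_eqF//; lra.
  by rewrite -[leRHS]dE ler_wpM2l//; lra.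
move=> /eqoP s_ln.
have scale : \forall n \near \oo, 4 * (4 + delta) * ln n%:R <= normF2 (Mmax n).
  pose d := (4 * (4 + delta))^-1.
  have d0 : 0 < d by rewrite invr_gt0; lra.
  near=> n.
  have h1 : ln n%:R <= d * normF2 (Mmax n).
    apply: le_trans (ler_norm _) _; rewrite -[X in d * X]ger0_norm//.
    by near: n; exact: s_ln.
  by move: h1; rewrite mulrC ler_pdivlMr 1?mulrC//; lra.
(* Here the scale is [ln n], and [n ^ 2 = expR (2 * ln n)]. *)
have card_le (Bs : {set block _}) n : (0 < n)%N -> (#|Bs| <= n ^ 2)%N ->
    #|Bs|%:R <= expR (2 * ln n%:R) :> R.
  move=> n0 cBs; rewrite expRM_natl lnK ?posrE ?ltr0n//.
  by rewrite -natrX ler_nat.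
rewrite /scan_con /scan_circ /tau_con; split.
  apply: risk_scan_cvg0 => //.
  near=> n; have n0 : (0 < n)%N by near: n; exact: nbhs_infty_gt.
  have /andP[_ kn'] := kn _ n0.
  by split => //; [apply: card_le => //; exact: card_blocks_con|near: n].
apply: risk_scan_cvg0 => //.
near=> n; have n0 : (0 < n)%N by near: n; exact: nbhs_infty_gt.
by split => //; [apply: card_le => //; exact: card_blocks_circ|near: n].
Unshelve. all: by end_near. Qed.
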